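(* Let $h\in\mathbb{R}$ be such that $\frac{h}{2\pi}$ is irrational and let $\mathcal{A}$ be the algebraic noncommutative torus over $\mathbb{Z}^2$ with the canonical symplectic form $\sigma_2$. Then the only $\mathrm{Sp}(2,\mathbb{Z})$-invariant state on $\mathcal{A}$ is the state $\tau$ defined, for every $m\in\mathbb{Z}^2$, by $$\tau(W_m)=\begin{cases}1 & \text{if } m=(0,0),\\ 0 & \text{otherwise.}\end{cases}$$
   Context: The canonical symplectic form on $\mathbb{Z}^2$ is $\sigma_2(m,n)=m^{t}\begin{pmatrix}0&-1\\1&0\end{pmatrix}n$. The algebraic noncommutative torus $\mathcal{A}$ is the complex vector space with basis $\{W_m\}_{m\in\mathbb{Z}^2}$, equipped with the bilinear product determined by $W_nW_m=e^{ih\sigma_2(n,m)}W_{n+m}$ and the antilinear involution determined by $W_m^*=W_{-m}$. Its unit is $W_{(0,0)}$. $\mathrm{Sp}(2,\mathbb{Z})=\mathrm{SL}(2,\mathbb{Z})$ is the group of integer $2\times 2$ matrices preserving $\sigma_2$. It acts on $\mathcal{A}$ by the $*$-automorphisms $\Phi_\Theta$ given by $\Phi_\Theta(W_m)=W_{\Theta m}$, extended linearly. A state is a linear functional $\omega:\mathcal{A}\to\mathbb{C}$ that is positive ($\omega(a^*a)\ge0$ for all $a\in\mathcal{A}$) and normalized ($\omega(W_{(0,0)})=1$); since $\mathcal{A}$ has basis $\{W_m\}$, it is determined by its values on the $W_m$. It is $\mathrm{Sp}(2,\mathbb{Z})$-invariant if $\omega\circ\Phi_\Theta=\omega$ for every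 $\Theta\in\mathrm{Sp}(2,\mathbb{Z})$. *)

(* Defs.v *)
From HB Require Import structures.
From mathcomp Require Import all_boot all_order all_algebra finmap.
From mathcomp Require Import classical_sets reals trigo.
From mathcomp Require Import complex monalg ring.

Set Implicit Arguments.
Unset Strict Implicit.
Unset Printing Implicit Defensive.

Import Order.TTheory GRing.Theory Num.Theory.

Local Open Scope ring_scope.
Local Open Scope complex_scope.

Notation Z2 := 'cV[int]_2.

Definition Jmx : 'M[int]_2 := \matrix_(i < 2, j < 2)
  (if i == j then 0 else if (i < j)%N then -1 else 1).

Definition sigma2 (m n : Z2) : int := (m^T *m Jmx *m n) 0 0.

Definition in_Sp2Z (T : 'M[int]_2) : Prop :=
  forall m n : Z2, sigma2 (T *m m) (T *m n) = sigma2 m n.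

Lemma sigma2E (m n : Z2) : sigma2 m n = m 1 0 * n 0 0 - m 0 0 * n 1 0.
Proof.
rewrite /sigma2 !mxE !big_ord_recr big_ord0 /= !mxE !big_ord_recr !big_ord0 /=.
rewrite !mxE /= !(add0r, addr0, mulr0, mulr1, mulrN1) mulNr.
have -> : widen_ord (leqnSn 1) ord_max = 0 :> 'I_2 by apply/val_inj.
by have -> : ord_max = 1 :> 'I_2 by apply/val_inj.
Qed.

Lemma sigma2Dl (m n p : Z2) : sigma2 (m + n) p = sigma2 m p + sigma2 n p.
Proof. by rewrite /sigma2 linearD /= !mulmxDl mxE. Qed.

Lemma sigma2Dr (m n p : Z2) : sigma2 p (m + n) = sigma2 p m + sigma2 p n.
Proof. by rewrite /sigma2 mulmxDr mxE. Qed.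

Lemma sigma20l (m : Z2) : sigma2 0 m = 0.
Proof. by rewrite sigma2E !mxE !mul0r subrr. Qed.

Lemma sigma20r (m : Z2) : sigma2 m 0 = 0.
Proof. by rewrite sigma2E !mxE !mulr0 subrr. Qed.

Lemma sigma2C (m n : Z2) : sigma2 m n = - sigma2 n m.
Proof. by rewrite !sigma2E opprB [m 0 0 * _]mulrC [m 1 0 * _]mulrC. Qed.

Lemma in_Sp2ZP (T : 'M[int]_2) : in_Sp2Z T <-> \det T = 1.
Proof.
have E m n : sigma2 (T *m m) (T *m n) = \det T * sigma2 m n.
  rewrite !sigma2E (expand_det_row _ 0) /cofactor !mxE.
  rewrite !big_ord_recl !big_ord0 /= !det_mx11 !mxE.
  have -> : lift 0 0 = 1 :> 'I_2 by apply/val_inj.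
  have -> : lift 1 0 = 0 :> 'I_2 by apply/val_inj.
  by rewrite expr0 expr1; ring.
split=> [S|d1 m n]; last by rewrite E d1 mul1r.
have := S (delta_mx 1 0) (delta_mx 0 0).
by rewrite E sigma2E !mxE /= mulr1 mulr0 subr0 mulr1.
Qed.

(* The exponential e^{ix}, by Euler's formula. *)
Definition expi (R : realType) (x : R) : R[i] := cos x +i* sin x.

Lemma expi0 (R : realType) : expi (0 : R) = 1.
Proof. by rewrite /expi cos0 sin0. Qed.

Lemma expiD (R : realType) (x y : R) : expi (x + y) = expi x * expi y.
Proof. by rewrite /expi cosD sinD addrC; congr (_ +i* _); rewrite addrC. Qed.

Lemma conjc_expi (R : realType) (x : R) : (expi x)^* = expi (- x).
Proof. by rewrite /expi cosN sinN. Qed.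

Section BasisExtension.
Variables (F : comNzRingType) (K : choiceType).
Implicit Types (a b : {malg F[K]}).

(* For s = id this is the linear map sending each basis vector << m >> to
   f m; for s the complex conjugation it is the antilinear one. *)
Definition basis_ext (s : F -> F) (V : lmodType F) (f : K -> V) a : V :=
  \sum_(m <- msupp a) s a@_m *: f m.

Lemma malg_sumU a : a = \sum_(m <- msupp a) a@_m *: << m >>.
Proof.
rewrite {1}[a]monalgE; apply: eq_bigr => m _; apply/malgP => k.
by rewrite mcoeffZ !mcoeffU mulrnAr mulr1.
Qed.

Variables (s : {rmorphism F -> F}) (V : lmodType F).
Implicit Type f : K -> V.

Lemma basis_extw (d : {fset K}) f a : (msupp a `<=` d)%fset ->
  basis_ext s f a = \sum_(m <- d) s a@_m *: f m.
Proof.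
move=> le; apply: big_fset_incl => // m _ /mcoeff_outdom ->.
by rewrite rmorph0 scale0r.
Qed.

Lemma basis_extP f k a b :
  basis_ext s f (k *: a + b) = s k *: basis_ext s f a + basis_ext s f b.
Proof.
pose d := (msupp a `|` msupp b)%fset.
have da : (msupp a `<=` d)%fset by apply: fsubsetUl.
have db : (msupp b `<=` d)%fset by apply: fsubsetUr.
have dab : (msupp (k *: a + b)%R `<=` d)%fset.
  apply: fsubset_trans (msuppD_le _ _) _; apply: fsetSU; exact: msuppZ_le.
rewrite (basis_extw _ da) (basis_extw _ db) (basis_extw _ dab).
rewrite scaler_sumr -big_split; apply: eq_bigr => m _ /=.
by rewrite mcoeffD mcoeffZ rmorphD rmorphM scalerDl scalerA.
Qed.

Lemma basis_extU f m : basis_ext s f << m >> = f m.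
Proof.
by rewrite (basis_extw f msuppU_le) big_seq_fset1 mcoeffUU rmorph1 scale1r.
Qed.

Lemma basis_ext0 f : basis_ext s f 0 = 0.
Proof. by rewrite /basis_ext msupp0 big_seq_fset0. Qed.

Lemma basis_extZ f k a : basis_ext s f (k *: a) = s k *: basis_ext s f a.
Proof. by have := basis_extP f k a 0; rewrite basis_ext0 !addr0. Qed.

Lemma basis_ext_unique f (g : {malg F[K]} -> V) :
  (forall k a b, g (k *: a + b) = s k *: g a + g b) ->
  (forall m, g << m >> = f m) -> g =1 basis_ext s f.
Proof.
move=> gP gU a; have g0 : g 0 = 0.
  have := gP 1 0 0; rewrite scaler0 add0r rmorph1 scale1r => e.
  by apply: (addrI (g 0)); rewrite addr0 -e.
rewrite {1}[a]malg_sumU /basis_ext.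
elim: (enum_fset _) => [|m r IH]; first by rewrite !big_nil.
by rewrite !big_cons gP IH gU.
Qed.

End BasisExtension.

Definition linext (F : comNzRingType) (K : choiceType) (V : lmodType F)
  (f : K -> V) : {malg F[K]} -> V := basis_ext id f.

Section LinearExtension.
Variables (F : comNzRingType) (K : choiceType) (V : lmodType F) (f : K -> V).
Implicit Types (a b : {malg F[K]}).

Lemma linextP : linear (linext f).
Proof. exact: (basis_extP idfun). Qed.

Lemma linextU m : linext f << m >> = f m.
Proof. exact: (basis_extU idfun). Qed.

Lemma linext0 : linext f 0 = 0.
Proof. exact: (basis_ext0 idfun). Qed.

Lemma linextZ k a : linext f (k *: a) = k *: linext f a.
Proof. exact: (basis_extZ idfun). Qed.

Lemma linext_unique (g : {malg F[K]} -> V) :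
  linear g -> (forall m, g << m >> = f m) -> g =1 linext f.
Proof. exact: (basis_ext_unique (s := idfun)). Qed.

End LinearExtension.

Lemma eq_on_basis (F : comNzRingType) (K : choiceType) (V : lmodType F)
    (s : {rmorphism F -> F}) (f g : {malg F[K]} -> V) :
  (forall k a b, f (k *: a + b) = s k *: f a + f b) ->
  (forall k a b, g (k *: a + b) = s k *: g a + g b) ->
  (forall m, f << m >> = g << m >>) -> f =1 g.
Proof.
move=> fP gP fg a; rewrite (basis_ext_unique fP (fun=> erefl)).
by rewrite (basis_ext_unique gP (fun m => esym (fg m))).
Qed.

Section TwistedGroupAlgebra.
Variables (F : comNzRingType) (G : zmodType) (u : G -> G -> F).
Local Notation A := {malg F[G]}.
Implicit Types (a b c : A).

Definition twisted_mul a b : A :=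
  linext (fun n => linext (fun m => u n m *: << n + m >>) b) a.

Local Notation "a ** b" := (twisted_mul a b) (at level 40).

Lemma twisted_mulE a b : a ** b =
  \sum_(n <- msupp a) a@_n *: linext (fun m => u n m *: << n + m >> : A) b.
Proof. by []. Qed.

Lemma twisted_mulU n m : << n >> ** << m >> = u n m *: << n + m >> :> A.
Proof. by rewrite /twisted_mul !linextU. Qed.

Lemma twisted_mulPl b k a c : (k *: a + c) ** b = k *: (a ** b) + c ** b.
Proof. exact: linextP. Qed.

Lemma twisted_mulPr a k b c : a ** (k *: b + c) = k *: (a ** b) + a ** c.
Proof.
rewrite !twisted_mulE scaler_sumr -big_split.
apply: eq_bigr => m _ /=.
by rewrite linextP scalerDr !scalerA [k * _]mulrC.
Qed.

Lemma twisted_mul0l b : 0 ** b = 0.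
Proof. exact: linext0. Qed.

Lemma twisted_mul0r a : a ** 0 = 0.
Proof.
rewrite twisted_mulE big1 // => m _.
by rewrite linext0 scaler0.
Qed.

Lemma twisted_mulZl k a b : (k *: a) ** b = k *: (a ** b).
Proof. exact: linextZ. Qed.

Lemma twisted_mulZr k a b : a ** (k *: b) = k *: (a ** b).
Proof. by rewrite -[k *: b]addr0 twisted_mulPr twisted_mul0r addr0. Qed.

Lemma twisted_mulDl : left_distributive twisted_mul +%R.
Proof. by move=> a c b; have := twisted_mulPl b 1 a c; rewrite !scale1r. Qed.

Lemma twisted_mulDr : right_distributive twisted_mul +%R.
Proof. by move=> a b c; have := twisted_mulPr a 1 b c; rewrite !scale1r. Qed.

Lemma twisted_mulA :
  (forall m n p, u n p * u m (n + p) = u m n * u (m + n) p) ->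
  associative twisted_mul.
Proof.
move=> uP a b c; pose id' : {rmorphism F -> F} := idfun.
apply: (eq_on_basis (s := id') (f := fun a => a ** (b ** c))
  (g := fun a => a ** b ** c)) a => [k x y|k x y|m].
- exact: twisted_mulPl.
- by rewrite !twisted_mulPl.
apply: (eq_on_basis (s := id') (f := fun b => << m >> ** (b ** c))
  (g := fun b => << m >> ** b ** c)) b => [k x y|k x y|n].
- by rewrite (twisted_mulPl c) (twisted_mulPr << m >>).
- by rewrite (twisted_mulPr << m >>) (twisted_mulPl c).
apply: (eq_on_basis (s := id') (f := fun c => << m >> ** (<< n >> ** c))
  (g := fun c => << m >> ** << n >> ** c)) c => [k x y|k x y|p].
- by rewrite (twisted_mulPr << n >>) (twisted_mulPr << m >>).
- exact: twisted_mulPr.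
rewrite (twisted_mulU n p) (twisted_mulZr (u n p)) (twisted_mulU m (n + p)).
rewrite (twisted_mulU m n) (twisted_mulZl (u m n)) (twisted_mulU (m + n) p).
by rewrite !scalerA uP addrA.
Qed.

Lemma twisted_mul1l : (forall m, u 0 m = 1) -> left_id << 0 >> twisted_mul.
Proof.
move=> u0; apply: (eq_on_basis (s := idfun)) => // [k x y|m].
  exact: twisted_mulPr.
by rewrite twisted_mulU u0 scale1r add0r.
Qed.

Lemma twisted_mul1r : (forall m, u m 0 = 1) -> right_id << 0 >> twisted_mul.
Proof.
move=> u0; apply: (eq_on_basis (s := idfun)
  (f := fun a => a ** << 0 >>)) => // [k x y|m].
  exact: twisted_mulPl.
by rewrite twisted_mulU u0 scale1r addr0.
Qed.

Lemma twisted_mul_star (s : {rmorphism F -> F}) :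
  (forall m n, s (u m n) = u (- n) (- m)) ->
  let star := basis_ext s (fun m => << - m >> : A) in
  forall a b, star (a ** b) = star b ** star a.
Proof.
move=> us star a b.
have starP k x y : star (k *: x + y) = s k *: star x + star y.
  exact: basis_extP.
have starU m : star << m >> = << - m >> by exact: basis_extU.
have starZ k x : star (k *: x) = s k *: star x by exact: basis_extZ.
apply: (eq_on_basis (s := s) (f := fun a => star (a ** b))
  (g := fun a => star b ** star a)) a => [k x y|k x y|m].
- by rewrite twisted_mulPl starP.
- by rewrite starP twisted_mulPr.
apply: (eq_on_basis (s := s) (f := fun b => star (<< m >> ** b))
  (g := fun b => star b ** star << m >>)) b => [k x y|k x y|n].
- by rewrite (twisted_mulPr << m >>) starP.
- by rewrite starP (twisted_mulPl (star << m >>)).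
rewrite (twisted_mulU m n) (starZ (u m n)) !starU (twisted_mulU (- n)).
by rewrite us opprD addrC.
Qed.

Lemma basis_ext_oppK (s : {rmorphism F -> F}) : involutive s ->
  involutive (basis_ext s (fun m => << - m >> : A)).
Proof.
move=> sK a; set star := basis_ext _ _.
apply: (eq_on_basis (s := idfun) (f := fun a => star (star a))
  (g := id)) a => [k x y|k x y|m] //; last by rewrite /star !basis_extU opprK.
by rewrite /star !basis_extP sK.
Qed.

Lemma basis_ext_opp_hom (s : {rmorphism F -> F}) (T : {additive G -> G}) :
  let star := basis_ext s (fun m => << - m >> : A) in
  let phi := linext (fun m => << T m >> : A) in
  forall a, phi (star a) = star (phi a).
Proof.
move=> star phi.
apply: (eq_on_basis (s := s) (f := fun a => phi (star a))
  (g := fun a => star (phi a))) => [k x y|k x y|m].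
- by rewrite /star basis_extP /phi linextP.
- by rewrite /phi linextP /star basis_extP.
- by rewrite /star /phi basis_extU !linextU basis_extU raddfN.
Qed.

Lemma twisted_mul_hom (T : {additive G -> G}) :
  (forall m n, u (T m) (T n) = u m n) ->
  let phi := linext (fun m => << T m >> : A) in
  forall a b, phi (a ** b) = phi a ** phi b.
Proof.
move=> uT phi a b.
have phiP : linear phi by exact: linextP.
have phiU m : phi << m >> = << T m >> by exact: linextU.
have phiZ k x : phi (k *: x) = k *: phi x by exact: linextZ.
apply: (eq_on_basis (s := idfun) (f := fun a => phi (a ** b))
  (g := fun a => phi a ** phi b)) a => [k x y|k x y|m].
- by rewrite twisted_mulPl phiP.
- by rewrite phiP twisted_mulPl.
apply: (eq_on_basis (s := idfun) (f := fun b => phi (<< m >> ** b))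
  (g := fun b => phi << m >> ** phi b)) b => [k x y|k x y|n].
- by rewrite (twisted_mulPr << m >>) phiP.
- by rewrite phiP (twisted_mulPr (phi << m >>)).
by rewrite (twisted_mulU m n) (phiZ (u m n)) !phiU (twisted_mulU (T m)) uT raddfD.
Qed.

End TwistedGroupAlgebra.

(* The parameter h only affects the product. *)
Definition nctorus (R : realType) (h : R) := {malg R[i][Z2]}.

HB.instance Definition _ (R : realType) (h : R) :=
  GRing.Lmodule.copy (nctorus h) {malg R[i][Z2]}.

Section NCTorus.
Variables (R : realType) (h : R).
Local Notation A := (nctorus h).
Implicit Types (a b : A).

Definition W (m : Z2) : A := << m >>.

Definition torus_mul : A -> A -> A :=
  twisted_mul (fun n m => expi (h * (sigma2 n m)%:~R)).

Lemma torus_mulA : associative torus_mul.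
Proof.
apply: twisted_mulA => m n p; rewrite -!expiD -!mulrDr -!intrD.
by rewrite sigma2Dl sigma2Dr addrC -addrA.
Qed.

Lemma torus_mul1l : left_id (W 0) torus_mul.
Proof. by apply: twisted_mul1l => m; rewrite sigma20l mulr0 expi0. Qed.

Lemma torus_mul1r : right_id (W 0) torus_mul.
Proof. by apply: twisted_mul1r => m; rewrite sigma20r mulr0 expi0. Qed.

Lemma W0_neq0 : W 0 != 0.
Proof. by rewrite monalgU_eq0 oner_eq0. Qed.

HB.instance Definition _ := GRing.Zmodule_isNzRing.Build A
  torus_mulA torus_mul1l torus_mul1r
  (@twisted_mulDl _ _ _) (@twisted_mulDr _ _ _) W0_neq0.

Lemma torus_scaleAl k a b : k *: (a * b) = k *: a * b.
Proof. exact/esym/twisted_mulZl. Qed.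

HB.instance Definition _ := GRing.Lmodule_isLalgebra.Build R[i] A torus_scaleAl.

Lemma torus_scaleAr k a b : k *: (a * b) = a * (k *: b).
Proof. exact/esym/twisted_mulZr. Qed.

HB.instance Definition _ := GRing.Lalgebra_isAlgebra.Build R[i] A torus_scaleAr.

Lemma torus1E : 1 = W 0.
Proof. by []. Qed.

Lemma mulWW n m : W n * W m = expi (h * (sigma2 n m)%:~R) *: W (n + m).
Proof. exact: twisted_mulU. Qed.

Definition star : A -> A := basis_ext (@conjc R) (fun m => W (- m)).

Lemma starP k a b : star (k *: a + b) = k^* *: star a + star b.
Proof. exact: (basis_extP (@conjc R)). Qed.

Lemma starW m : star (W m) = W (- m).
Proof. exact: (basis_extU (@conjc R)). Qed.

Lemma starM a b : star (a * b) = star b * star a.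
Proof.
apply: (twisted_mul_star (s := @conjc R)) => m n.
rewrite [LHS]conjc_expi -mulrN -mulrNz -sigma2C.
by rewrite [in RHS]sigma2E !mxE !mulrNN -sigma2E.
Qed.

Lemma starK : involutive star.
Proof. exact/(basis_ext_oppK (s := @conjc R))/conjcK. Qed.

Definition Phi (T : 'M[int]_2) : A -> A := linext (fun m => W (T *m m)).

Lemma Phi_is_linear T : linear (Phi T).
Proof. exact: linextP. Qed.

HB.instance Definition _ T :=
  GRing.isLinear.Build R[i] A A *:%R (Phi T) (Phi_is_linear T).

Lemma PhiW T m : Phi T (W m) = W (T *m m).
Proof. exact: linextU. Qed.

Lemma PhiM T a b : in_Sp2Z T -> Phi T (a * b) = Phi T a * Phi T b.
Proof.
by move=> TSp; apply: (twisted_mul_hom (T := mulmx T)) => m n; rewrite TSp.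
Qed.

Lemma Phi_star T a : Phi T (star a) = star (Phi T a).
Proof. exact: (basis_ext_opp_hom (@conjc R) (mulmx T)). Qed.

(* In the partial order of R[i], 0 <= z means that z is real and nonnegative. *)
Definition is_state (omega : {scalar A}) : Prop :=
  (forall a, 0 <= omega (star a * a)) /\ omega (W 0) = 1.

Definition Sp2Z_invariant (omega : {scalar A}) : Prop :=
  forall T, in_Sp2Z T -> forall a, omega (Phi T a) = omega a.

Definition tau : A -> R[i] :=
  linext (V := R[i]^o) (fun m => if m == 0 then 1 else 0).

Lemma tau_is_scalar : scalar tau.
Proof. exact: linextP. Qed.

HB.instance Definition _ :=
  GRing.isLinear.Build R[i] A R[i] *%R tau tau_is_scalar.

Lemma tauW m : tau (W m) = if m == 0 then 1 else 0.
Proof. exact: (linextU (V := R[i]^o)). Qed.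

End NCTorus.

Arguments W {R} h m.
Arguments tau {R} h a.

(* Main.v *)
Require Import Defs.
From mathcomp Require Import all_boot all_order all_algebra.
From mathcomp Require Import classical_sets reals trigo.
From mathcomp Require Import finmap complex monalg ring lra zify.

(* By Cauchy-Schwarz, [|omega a|^2 <= omega (a^* a)].  Fix [d <> 0], [N] and
   [M = N!], and let [a] be the sum of the [W (n d, (1 + M j) d)] for
   [1 <= n <= N] and [j < J].  Since [n] and [1 + M j] are coprime, invariance
   gives all these vectors the same value [F = omega (W (d, 0))], so that
   [omega a = N J F].  Write [omega (a^* a)] as a sum of kernel values
   [omega (W_p^* W_q)].  Shifting [j] and [k] together in the block of a pair
   [n, m] keeps the difference of the vectors and multiplies the kernel by the
   constant phase [exp (- i h M d^2 (m - n))], which is not [1] for [n <> m]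
   because [h / 2 pi] is irrational; hence that block is only [O(J)], while the
   diagonal blocks are at most [J^2].  Thus [N^2 J^2 |F|^2 <= N J^2 + O_N(J)];
   letting [J], then [N], go to infinity yields [F = 0].  Every nonzero vector
   lies in the orbit of such a [(d, 0)]. *)

Set Implicit Arguments.
Unset Strict Implicit.
Unset Printing Implicit Defensive.

Import Order.TTheory GRing.Theory Num.Theory.
Local Open Scope ring_scope.

(** * Phases on the unit circle and complex norm bounds *)

Section ExpI.
Variable R : realType.
Local Open Scope complex_scope.

Lemma expi_mulrn (x : R) n : expi (x *+ n) = expi x ^+ n.
Proof. by elim: n => [|n IH]; rewrite ?expi0 // mulrS expiD IH exprS. Qed.

Lemma expi_periodic (k : int) : expi (2 * pi *~ k : R) = 1.
Proof.
have E n : expi (2 * pi *+ n : R) = 1.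
  by rewrite expi_mulrn mulr_natl /expi cos2pi sin2pi expr1n.
case: k => n; first exact: E.
by rewrite NegzE mulrNz -pmulrn -conjc_expi E conjc1.
Qed.

(** Reduce [x] modulo [2 * pi] to [y] in [[0, 2 * pi)]. If [y > 0], then [y / 2] lies strictly
    between 0 and [pi], where the sine is positive; but [expi (y / 2)] squares to 1, so it is 1 or
    -1 and its imaginary part vanishes. *)
Lemma expi_eq1 (x : R) : expi x = 1 -> exists k : int, x = 2 * pi *~ k.
Proof.
have p0 : 0 < 2 * pi :> R by rewrite mulr_gt0 // pi_gt0.
set k := Num.floor (x / (2 * pi)); set y := x - 2 * pi *~ k => x1.
exists k; apply/eqP; rewrite -subr_eq0 -/y.
have y1 : expi y = 1.
  by rewrite /y expiD x1 mul1r -mulrNz expi_periodic.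
have y_ge0 : 0 <= y.
  by rewrite subr_ge0 -mulrzl -ler_pdivlMr // floor_le.
have y_lt : y < 2 * pi.
  have := floorD1_gt (x / (2 * pi)); rewrite ltr_pdivrMr // -/k intrD mulrDl.
  by rewrite mul1r mulrzl ltrBlDr addrC.
rewrite eq_le y_ge0 andbT leNgt; apply/negP => y_gt0.
have /sin_gt0_pi : 0 < y / 2 < pi.
  by rewrite divr_gt0 //= ltr_pdivrMr // mulrC.
suff -> : sin (y / 2) = 0 by rewrite ltxx.
have : expi (y / 2) ^+ 2 == 1 by rewrite -expi_mulrn mulr2n -splitr y1.
by rewrite sqrf_eq1 => /orP[]/eqP/(congr1 (@complex.Im R))/= ->; rewrite ?oppr0.
Qed.

Lemma normr_expi (x : R) : `|expi x| = 1.
Proof. by rewrite normc_def /= cos2Dsin2 sqrtr1. Qed.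

Lemma expi_irrational_neq1 (h : R) (z : int) :
  irrational (h / (2 * pi)) -> z != 0 -> expi (h * z%:~R) != 1.
Proof.
move=> hirr z0; apply/eqP => /expi_eq1[k hk]; apply: hirr.
have zR : z%:~R != 0 :> R by rewrite intr_eq0.
have pi0 : 2 * pi != 0 :> R by rewrite mulf_neq0 // gt_eqF ?pi_gt0.
exists (k%:~R / z%:~R) => //; rewrite fmorph_div !rmorph_int.
by apply/eqP; rewrite eqr_div // hk mulrzl.
Qed.

Lemma complex_archi (x : R[i]) : exists n : nat, `|x| <= n%:R.
Proof.
rewrite normc_def; set r := Num.sqrt _; exists (Num.bound r).
rewrite -(rmorph_nat (real_complex R)) lecR.
by apply/ltW/(le_lt_trans _ (archi_boundP _)); rewrite ?sqrtr_ge0.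
Qed.

Lemma sqr_normcE (x : R[i]) : `|x| ^+ 2 = x * x^*.
Proof. exact: normCK. Qed.

End ExpI.

(* Multiplying by [1 - q] telescopes the sum along the diagonals, leaving only
   boundary terms. *)
Lemma twisted_square_sum (C : numFieldType) (A : nat -> nat -> C) (q : C) J :
  (forall j k, `|A j k| <= 1) -> (forall j k, A j.+1 k.+1 = q * A j k) ->
  `|1 - q| * `|\sum_(j < J) \sum_(k < J) A j k| <= (4 * J + 2)%:R.
Proof.
move=> A1 Aq; set S := \sum_(j < J) _.
have sum_le n (B : nat -> C) : (forall j, `|B j| <= 1) ->
    `|\sum_(j < n) B j| <= n%:R.
  move=> B1; apply: (le_trans (ler_norm_sum _ _ _)).
  apply: (le_trans (ler_sum _ (G := fun=> 1) _)) => //.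
  by rewrite sumr_const card_ord.
(* The square of side [J.+1] is cut in two ways: without its first row and column it sums to
   [q * S], without its last ones to [S]. *)
have eS0 : \sum_(j < J.+1) \sum_(k < J.+1) A j k =
    \sum_(k < J.+1) A 0%N k + (\sum_(j < J) A j.+1 0%N + q * S).
  rewrite big_ord_recl mulr_sumr -big_split /=; congr (_ + _).
  apply: eq_bigr => j _; rewrite big_ord_recl mulr_sumr; congr (_ + _).
  by apply: eq_bigr => k _; rewrite Aq.
have eS1 : \sum_(j < J.+1) \sum_(k < J.+1) A j k =
    S + \sum_(j < J) A j J + \sum_(k < J.+1) A J k.
  rewrite big_ord_recr -big_split /=; congr (_ + _).
  by apply: eq_bigr => j _; rewrite big_ord_recr.
have eS : (1 - q) * S = \sum_(k < J.+1) A 0%N k + \sum_(j < J) A j.+1 0%N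
    - (\sum_(j < J) A j J + \sum_(k < J.+1) A J k).
  apply/eqP; rewrite -subr_eq0; move: eS0; rewrite eS1 => /eqP.
  by rewrite -subr_eq0 => /eqP e; apply/eqP; rewrite -{}[RHS]e; ring.
rewrite -normrM eS (le_trans (ler_normB _ _)) //.
have -> : (4 * J + 2 = (J.+1 + J) + (J + J.+1))%N by lia.
rewrite !natrD; apply: lerD; apply: (le_trans (ler_normD _ _)); apply: lerD.
- exact: (sum_le _ (A 0%N)).
- exact: (sum_le _ (fun j => A j.+1 0%N)).
- exact: (sum_le _ (A^~ J)).
- exact: (sum_le _ (A J)).
Qed.

(** * The involution and products of the form [star (W p) * W q] *)

Section Star.
Variables (R : realType) (h : R).
Local Notation A := (nctorus h).
Local Notation W := (W h).
Local Open Scope complex_scope.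

Lemma starZ k (a : A) : star (k *: a) = k^* *: star a.
Proof. exact: (basis_extZ (@conjc R)). Qed.

Lemma starD (a b : A) : star (a + b) = star a + star b.
Proof. by have := starP 1 a b; rewrite rmorph1 !scale1r. Qed.

Lemma star0 : star (0 : A) = 0.
Proof. exact: (basis_ext0 (@conjc R)). Qed.

Lemma star_sum I (r : seq I) (a : I -> A) :
  star (\sum_(i <- r) a i) = \sum_(i <- r) star (a i).
Proof. exact: (big_morph _ starD star0). Qed.

Lemma starWM p q :
  star (W p) * W q = expi (- (h * (sigma2 p q)%:~R)) *: W (q - p).
Proof.
have -> : q - p = - p + q :> Z2 by rewrite addrC.
have -> : - (h * (sigma2 p q)%:~R) = h * (sigma2 (- p) q)%:~R.
  by rewrite -mulrN -mulrNz !sigma2E !mxE; congr (h * _%:~R); ring.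
by rewrite starW mulWW.
Qed.

Lemma starWW m : star (W m) * W m = W 0.
Proof.
have sigma2_mm : sigma2 m m = 0 by rewrite sigma2E mulrC subrr.
by rewrite starWM sigma2_mm mulr0 oppr0 expi0 scale1r subrr.
Qed.

Lemma scalar_starWM (omega : {scalar A}) p q : omega (star (W p) * W q) =
  expi (- (h * (sigma2 p q)%:~R)) * omega (W (q - p)).
Proof. by rewrite starWM; exact: linearZ. Qed.

Lemma sum_star_mul (omega : {scalar A}) I J (r : seq I) (s : seq J)
    (a : I -> A) (b : J -> A) :
  omega (star (\sum_(i <- r) a i) * \sum_(j <- s) b j) =
  \sum_(i <- r) \sum_(j <- s) omega (star (a i) * b j).
Proof.
rewrite star_sum mulr_suml linear_sum; apply: eq_bigr => i _ /=.
by rewrite mulr_sumr linear_sum.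
Qed.

End Star.

(** * Hermitian symmetry and Cauchy-Schwarz for states *)

Section State.
Variables (R : realType) (h : R) (omega : {scalar nctorus h}).
Hypothesis st : is_state omega.
Local Notation A := (nctorus h).
Local Notation W := (W h).
Local Open Scope complex_scope.

(** Positivity at [k *: W 0 + a], expanded; the choices of [k] below yield both symmetry and
    Cauchy-Schwarz. *)
Let state_expand_ge0 (k : R[i]) (a : A) :
  0 <= k^* * k + k^* * omega a + k * omega (star a) + omega (star a * a).
Proof.
have scaleW0l c b : (c *: W 0) * b = c *: b.
  by rewrite -(scalerAl c (W 0) b); congr (_ *: _); exact: mul1r.
have scaleW0r c b : b * (c *: W 0) = c *: b.
  by rewrite -(scalerAr c b (W 0)); congr (_ *: _); exact: mulr1.
have expand b : (k^* *: W 0 + b) * (k *: W 0 + a) =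
    (k^* * k) *: W 0 + (k^* *: a + (k *: b + b * a)).
  rewrite mulrDl (mulrDr b) scaleW0l (scaleW0r k b) scalerDr.
  by rewrite (scalerA k^* k) -addrA.
have := st.1 (k *: W 0 + a).
have -> : star (k *: W 0 + a) = k^* *: W 0 + star a.
  by rewrite starP starW oppr0.
by rewrite expand 3!linearP st.2 mulr1 !addrA.
Qed.

Lemma state_star a : omega (star a) = (omega a)^*.
Proof.
(* A nonnegative element of [R[i]] has zero imaginary part: [k = 1] makes the imaginary parts of [s]
   and [t] opposite, [k = 'i] makes their real parts equal. *)
have conj_of_ge0 (s t z : R[i]) :
    0 <= 1^* * 1 + 1^* * s + 1 * t + z ->
    0 <= 'i^* * 'i + 'i^* * s + 'i * t + z -> 0 <= z -> t = s^*.
  case: s t z => [x y] [x' y'] [u w]; rewrite !lecE /=.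
  move=> /andP[/eqP e1 _] /andP[/eqP e2 _] /andP[/eqP e3 _].
  by congr (_ +i* _); lra.
exact: conj_of_ge0 (state_expand_ge0 1 a) (state_expand_ge0 'i a) (st.1 a).
Qed.

(** The choice [k = - omega a] minimizes the quadratic expression in [k]. *)
Lemma state_cauchy_schwarz a : `|omega a| ^+ 2 <= omega (star a * a).
Proof.
have complete_square (s t z : R[i]) : t = s^* ->
    0 <= (- s)^* * (- s) + (- s)^* * s + (- s) * t + z -> `|s| ^+ 2 <= z.
  move=> ->; rewrite sqr_normcE -[_ <= z]subr_ge0 rmorphN.
  by congr (_ <= _); ring.
exact: complete_square (state_star a) (state_expand_ge0 (- omega a) a).
Qed.

Lemma state_W_le1 m : `|omega (W m)| <= 1.
Proof.
have o1 : omega (star (W m) * W m) = 1 by rewrite starWW; exact: st.2.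
rewrite -(@expr_le1 _ 2) //; apply: le_trans (state_cauchy_schwarz _) _.
by rewrite o1.
Qed.

End State.

(** * The trace [tau] is an invariant state *)

Section Tau.
Variables (R : realType) (h : R).
Local Notation A := (nctorus h).
Local Notation W := (W h).
Local Open Scope complex_scope.

Lemma tau_starWM p q : tau h (star (W p) * W q) = (p == q)%:R.
Proof.
case: eqP => [->|/eqP pq]; first by rewrite starWW tauW eqxx.
by rewrite scalar_starWM /= tauW subr_eq0 eq_sym (negPf pq) mulr0.
Qed.

(** The [W m] are orthonormal for [tau (star a * b)], so [tau (star a * a)] is the sum of the
    squared moduli of the coefficients of [a]. *)
Lemma tau_state : is_state (tau h).
Proof.
split=> [a|]; last by rewrite /= tauW eqxx.
rewrite {1 2}[a]malg_sumU sum_star_mul big_seq sumr_ge0 // => m ma.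
rewrite (bigD1_seq m) ?fset_uniq //= big1 => [|n nm].
  rewrite addr0 starZ -scalerAl -scalerAr !linearZ /=.
  by rewrite tau_starWM eqxx mulr1 mulrC mulcJ_ge0.
rewrite starZ -scalerAl -scalerAr !linearZ /=.
by rewrite tau_starWM eq_sym (negPf nm) !mulr0.
Qed.

Lemma tau_invariant : Sp2Z_invariant (tau h).
Proof.
move=> T /in_Sp2ZP dT a.
have uT : T \in unitmx by rewrite unitmxE dT unitr1.
apply: (eq_on_basis (s := idfun) (V := R[i]^o) (f := fun a => tau h (Phi T a))
  (g := tau h)) a => [k a b|k a b|m]; rewrite ?linearP //.
rewrite PhiW /= !tauW; congr (if _ then _ else _).
by rewrite -[in RHS](can_eq (mulKmx uT)) mulmx0.
Qed.

End Tau.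

(** * Integer vectors and their orbits *)

Definition vec (x y : int) : Z2 := \col_i (if i == 0 then x else y).

Lemma sigma2_vec x y x' y' : sigma2 (vec x y) (vec x' y') = y * x' - x * y'.
Proof. by rewrite sigma2E !mxE. Qed.

Lemma vecB x y x' y' : vec x y - vec x' y' = vec (x - x') (y - y').
Proof. by apply/matrixP => i j; rewrite !mxE; case: ifP. Qed.

Lemma vec_eta (m : Z2) : m = vec (m 0 0) (m 1 0).
Proof.
apply/matrixP => i j; rewrite !mxE ord1; case: ifP => [/eqP->//|].
by case: i => [[|[|]]] // p _; congr (m _ _); apply/val_inj.
Qed.

(** The Bezout relation says that the matrix with columns [(p, q)] and [(- v, u)] has determinant
    1. *)
Lemma Sp2Z_orbit (d p q u v : int) : u * p + v * q = 1 ->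
  exists2 T, in_Sp2Z T & T *m vec d 0 = vec (p * d) (q * d).
Proof.
move=> uv1.
exists (\matrix_(i, j) if i == 0 then if j == 0 then p else - v
                       else if j == 0 then q else u).
  move=> m n; rewrite !sigma2E !mxE !big_ord_recl !big_ord0 /= !mxE /=.
  have -> : lift 0 0 = 1 :> 'I_2 by apply/val_inj.
  by rewrite -[RHS]mul1r -uv1; ring.
apply/matrixP => i j; rewrite !mxE !big_ord_recl !big_ord0 /= !mxE /=.
by case: ifP => _; ring.
Qed.

(** * Uniqueness of the invariant state *)

Section InvariantState.
Variables (R : realType) (h : R) (omega : {scalar nctorus h}).
Hypotheses (h_irr : irrational (h / (2 * pi)))
  (st : is_state omega) (inv : Sp2Z_invariant omega).
Local Notation W := (W h).
Local Open Scope complex_scope.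

Lemma invariant_orbit (d p q u v : int) : u * p + v * q = 1 ->
  omega (W (vec (p * d) (q * d))) = omega (W (vec d 0)).
Proof. by move=> /(Sp2Z_orbit d)[T TSp <-]; rewrite -PhiW inv. Qed.

Let K p q := omega (star (W p) * W q).

Lemma kernelE p q :
  K p q = expi (- (h * (sigma2 p q)%:~R)) * omega (W (q - p)).
Proof. exact: scalar_starWM. Qed.

Lemma normr_kernel_le1 p q : `|K p q| <= 1.
Proof. by rewrite kernelE normrM normr_expi mul1r state_W_le1. Qed.

Section Family.
Variables (d : int) (N : nat).
Hypothesis d0 : d != 0.

(* Since [n.+1] divides [N`!], all these vectors lie in the orbit of
   [vec d 0]. *)
Let v (n j : nat) := vec (n.+1%:Z * d) ((1 + N`!%:Z * j%:Z) * d).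
Let q (n m : nat) : R[i] :=
  expi (- (h * (N`!%:Z * d ^+ 2 * (m%:Z - n%:Z))%:~R)).

Lemma family_orbit n j : (n < N)%N ->
  omega (W (v n j)) = omega (W (vec d 0)).
Proof.
move=> nN; have /dvdnP[r Er] : (n.+1 %| N`!)%N by rewrite dvdn_fact.
(* Bezout coefficients for [n.+1] and [1 + N! j], from [N! = r * n.+1]. *)
apply: (@invariant_orbit _ _ _ (- (r%:Z * j%:Z)) 1).
by rewrite Er PoszM; ring.
Qed.

Lemma family_kernelS n m j k :
  K (v n j.+1) (v m k.+1) = q n m * K (v n j) (v m k).
Proof.
rewrite !kernelE mulrA -expiD -opprD -mulrDr -intrD !vecB !sigma2_vec.
congr (expi (- (h * _%:~R)) * omega (W (vec _ _))); rewrite ?intS; ring.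
Qed.

Lemma twist_neq1 n m : n != m -> q n m != 1.
Proof.
move=> nm; rewrite /q -mulrN -mulrNz expi_irrational_neq1 // oppr_eq0.
rewrite !mulf_neq0 ?expf_neq0 ?subr_eq0 ?eqz_nat //; last by rewrite eq_sym.
by rewrite -lt0n fact_gt0.
Qed.

(** The 6 comes from [4 * J + 2 <= 6 * J] for [J > 0]. On the diagonal [q n n = 1], and division by
    zero gives 0. *)
Let D n m : R[i] := 6 / `|1 - q n m|.

Let D_ge0 n m : 0 <= D n m. Proof. exact: divr_ge0. Qed.

Lemma family_block_le J n m : (0 < J)%N ->
  `|\sum_(j < J) \sum_(k < J) K (v n j) (v m k)| <=
  (n == m)%:R * J%:R ^+ 2 + J%:R * D n m.
Proof.
move=> J0; case: eqP => [->|/eqP nm].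
  rewrite mul1r ler_wpDr ?(mulr_ge0 _ (D_ge0 _ _)) //.
  apply: (le_trans (ler_norm_sum _ _ _)).
  have -> : J%:R ^+ 2 = \sum_(j < J) \sum_(k < J) 1 :> R[i].
    by rewrite !sumr_const card_ord -mulrnA natrM.
  apply: ler_sum => j _; apply: (le_trans (ler_norm_sum _ _ _)).
  by apply: ler_sum => k _; exact: normr_kernel_le1.
have q1 : 0 < `|1 - q n m| by rewrite normr_gt0 subr_eq0 eq_sym twist_neq1.
rewrite mul0r add0r /D mulrA ler_pdivlMr // mulrC.
apply: (@le_trans _ _ (4 * J + 2)%:R); last by rewrite -natrM ler_nat; lia.
apply: (@twisted_square_sum _ (fun j k => K (v n j) (v m k))) => j k.
  exact: normr_kernel_le1.
exact: family_kernelS.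
Qed.

Lemma invariant_norm_le : N%:R * `|omega (W (vec d 0))| ^+ 2 <= 2.
Proof.
have [->|N0] := posnP N; first by rewrite mul0r.
set F := omega _.
(* With [J] above the sum of all [D n m], the error [J] times that sum is at most [N J^2], the size
   of the diagonal term; hence the final bound 2. *)
have [J0 leJ0] := complex_archi (\sum_(n < N) \sum_(m < N) D n m).
set J := J0.+1.
have NR : 0 < N%:R :> R[i] by rewrite ltr0n.
have JR : 0 < J%:R :> R[i] by rewrite ltr0n.
have := state_cauchy_schwarz st (\sum_(n < N) \sum_(j < J) W (v n j)).
have -> : omega (\sum_(n < N) \sum_(j < J) W (v n j)) = N%:R * J%:R * F.
  rewrite linear_sum (eq_bigr (fun=> J%:R * F)) /= => [|n _].
    by rewrite sumr_const card_ord -mulrA [RHS]mulr_natl.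
  rewrite linear_sum (eq_bigr (fun=> F)) => [|j _]; last exact: family_orbit.
  by rewrite sumr_const card_ord mulr_natl.
(* The nonnegative right-hand side is replaced by its norm, so that the triangle inequality splits
   it into blocks. *)
rewrite -[leRHS]ger0_norm ?st.1 // sum_star_mul => leF.
have : `|N%:R * J%:R * F| ^+ 2 <=
    \sum_(n < N) \sum_(m < N) ((n == m)%:R * J%:R ^+ 2 + J%:R * D n m).
  apply: (le_trans leF); apply: (le_trans (ler_norm_sum _ _ _)).
  apply: ler_sum => n _; apply: (le_trans (ler_norm_sum _ _ _)).
  by apply: ler_sum => m _; rewrite sum_star_mul; exact: family_block_le.
have -> : \sum_(n < N) \sum_(m < N) ((n == m)%:R * J%:R ^+ 2 + J%:R * D n m) =
    N%:R * J%:R ^+ 2 + J%:R * \sum_(n < N) \sum_(m < N) D n m.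
  have -> : N%:R * J%:R ^+ 2 = \sum_(n < N) J%:R ^+ 2 :> R[i].
    by rewrite sumr_const card_ord mulr_natl.
  rewrite mulr_sumr -big_split /=.
  apply: eq_bigr => n _; rewrite big_split /= mulr_sumr; congr (_ + _).
  rewrite (bigD1 n) //= eqxx mul1r big1 ?addr0 // => m /negPf.
  by rewrite eq_sym => ->; rewrite mul0r.
move=> leS; rewrite -(ler_pM2l (mulr_gt0 NR (exprn_gt0 2 JR))).
have -> : N%:R * J%:R ^+ 2 * (N%:R * `|F| ^+ 2) = `|N%:R * J%:R * F| ^+ 2.
  by rewrite !normrM !normr_nat; ring.
apply: (le_trans leS); rewrite mulr_natr mulr2n lerD2l.
rewrite expr2 mulrCA ler_pM2l //.
apply: (@le_trans _ _ J0%:R).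
  apply: le_trans leJ0; rewrite real_ler_norm // ger0_real // !sumr_ge0 // => n _.
  exact: sumr_ge0.
by rewrite -natrM ler_nat; nia.
Qed.

End Family.

Lemma invariant_axis (d : int) : d != 0 -> omega (W (vec d 0)) = 0.
Proof.
move=> d0; set F := omega _; apply/eqP/contraT => F0.
have X0 : 0 < `|F| ^+ 2 by rewrite exprn_gt0 ?normr_gt0.
(* Any constant above 2 would do: this [n] gives [3 <= n |F|^2], against the bound 2 for [N = n]. *)
have [n] := complex_archi (3 / `|F| ^+ 2).
rewrite ger0_norm; last by apply: divr_ge0 => //; exact: ltW.
rewrite ler_pdivrMr // => le3.
have := le_trans le3 (invariant_norm_le n d0).
by rewrite ler_nat.
Qed.

(** With [d] the gcd of the coordinates, dividing the Bezout identity by [d] puts [m] in the orbit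
    of [vec d 0]. *)
Lemma invariant_neq0 (m : Z2) : m != 0 -> omega (W m) = 0.
Proof.
rewrite (vec_eta m); set x := m 0 0; set y := m 1 0 => m0.
have [u [w uw]] := Bezoutz x y; set d := gcdz x y in uw.
have d0 : d != 0.
  apply: contraNneq m0 => /eqP; rewrite gcdz_eq0 => /andP[/eqP-> /eqP->].
  by apply/eqP/matrixP => i j; rewrite !mxE; case: ifP.
have /dvdzP[p Ep] : (d %| x)%Z by exact: dvdz_gcdl.
have /dvdzP[q Eq] : (d %| y)%Z by exact: dvdz_gcdr.
rewrite Ep Eq (@invariant_orbit _ _ _ u w) ?invariant_axis //.
by apply: (mulIf d0); rewrite mul1r mulrDl -!mulrA -Ep -Eq.
Qed.

Lemma invariant_eq_tau : omega =1 tau h.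
Proof.
apply: (eq_on_basis (s := idfun) (V := R[i]^o)) => [k a b|k a b|m];
  rewrite ?linearP //.
change (omega (W m) = tau h (W m)); rewrite tauW.
by case: eqVneq => [->|/invariant_neq0//]; case: st.
Qed.

End InvariantState.

Theorem theorem2p2 (R : realType) (h : R)
    (h_irrational : irrational (h / (2 * pi))) :
  [/\ is_state (tau h), Sp2Z_invariant (tau h)
    & forall omega : {scalar nctorus h},
        is_state omega -> Sp2Z_invariant omega -> omega =1 tau h].
Proof.
split; [exact: tau_state | exact: tau_invariant |].
by move=> omega; exact: invariant_eq_tau.
Qed.
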